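(* Let $\mathbf{x}$ be an infinite word that is $P$-power-free for some integer $P\ge1$, and let $\boldsymbol{\tau}=(\tau_n\colon\mathcal{A}_{n+1}^*\to\mathcal{A}_n^*,\ a_n\in\mathcal{A}_n)_{n\ge0}$ be a congenial sequence generating $\mathbf{x}$ satisfying: (P) there exists $k\in\mathbb{N}$ such that $\tau_{n,n+k}$ is positive for all $n\ge0$; (F) the set $\{\tau_n:n\ge0\}$ is finite; (D) for every $n\ge0$, $\tau_n$ is decisive in $\mathbf{x}^{(n+1)}$. Suppose moreover there is $K>0$ such that $|\tau_n(a)|\le K$ for all $n\ge0$, $a\in\mathcal{A}_{n+1}$, and $|\mathcal{A}_n|\le K$ for all $n\ge0$, and such that $|\tau_{0,n}(a)|\le K\,|\tau_{0,n}(b)|$ for all $n\ge1$ and $a,b\in\mathcal{A}_n$. Let $\mathbf{x}^{(n)}$ denote the limit of $(\tau_{n,m}(a_m))_{m>n}$, and suppose there is a sequence $(B_n)_{n\ge0}$ such that $\mathbf{x}^{(n)}$ is $B_n$-letter-balanced for all $n$. Then $\mathbf{x}$ is factor-balanced. Moreover, if $(B_n)_{n\ge0}$ is bounded, then $\mathbf{x}$ is uniformly factor-balanced.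
   Context: A word is $P$-power-free if none of its factors has the form $w^P$ with $w$ nonempty. Congenial sequences: $\mathcal{A}_n$ finite alphabets, $\tau_n$ substitutions, $a_n\in\mathcal{A}_n$ with $\tau_n(a_{n+1})$ beginning with $a_n$; $\tau_{m,n}=\tau_m\circ\cdots\circ\tau_{n-1}$ for $n>m$; $\mathbf{x}^{(m)}=\lim_n\tau_{m,n}(a_n)$ and the sequence generates $\mathbf{x}=\mathbf{x}^{(0)}$. $\tau_{m,n}$ is positive if each $b\in\mathcal{A}_m$ occurs in $\tau_{m,n}(a)$ for each $a\in\mathcal{A}_n$. A substitution $\tau\colon\mathcal{A}^*\to\mathcal{B}^*$ is $k$-decisive in $\mathbf{y}\in\mathcal{A}^{\mathbb{N}}$ if there is $r\colon\mathcal{A}\to\mathcal{B}^k$ with $\tau(b)$ beginning with $r(a)$ whenever $ab$ is a factor of $\mathbf{y}$; decisive means $k$-decisive for some $k\ge1$. With $|u|_w$ the number of (possibly overlapping) occurrences of $w$ in $u$: a word $w$ is $C$-balanced in $\mathbf{y}$ if $\big||u|_w-|v|_w\big|\le C$ for all factors $u,v$ of $\mathbf{y}$ of equal length; $\mathbf{y}$ is $C$-letter-balanced if all letters are $C$-balanced; factor-balanced if each $w$ is $C_w$-balanced for some $C_w$; uniformly factor-balanced if one $C$ works for all $w$. *)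

(* Defs.v *)
From mathcomp Require Import all_boot ssrint.
From mathcomp Require Import finmap.

Set Implicit Arguments.
Unset Strict Implicit.
Unset Printing Implicit Defensive.

(** Finite words over [T] are elements of [seq T], infinite words are functions
    [nat -> T], and a substitution is given by the images of the letters. *)

Section Words.
Variable T : eqType.
Implicit Types (y : nat -> T) (u v w : seq T).

Definition factor y u : Prop :=
  exists i, u = [seq y j | j <- iota i (size u)].

Definition word_power w (P : nat) : seq T := flatten (nseq P w).

Definition power_free (P : nat) y : Prop :=
  forall w, w != [::] -> ~ factor y (word_power w P).

(** Overlapping occurrences; the range [0 .. size u] includes the end of [u],
    which only matters for the empty word. *)
Definition occ w u : nat :=
  count (fun i => prefix w (drop i u)) (iota 0 (size u).+1).

Definition balanced y w (C : nat) : Prop :=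
  forall u v, factor y u -> factor y v -> size u = size v ->
    `|occ w u - occ w v|%N <= C.

Definition letter_balanced y (C : nat) : Prop :=
  forall c : T, balanced y [:: c] C.

Definition factor_balanced y : Prop :=
  forall w, exists C, balanced y w C.

Definition uniformly_factor_balanced y : Prop :=
  exists C, forall w, balanced y w C.

Definition word_limit (s : nat -> seq T) y : Prop :=
  forall l, exists N, forall n, N <= n -> prefix (mkseq y l) (s n).

End Words.

Definition extend (S T : Type) (f : S -> seq T) (w : seq S) : seq T :=
  flatten (map f w).

Definition k_decisive (S T : eqType) (f : S -> seq T) (y : nat -> S) (k : nat) :
    Prop :=
  exists r : S -> k.-tuple T,
    forall a b, factor y [:: a; b] -> prefix (r a) (f b).

Definition decisive (S T : eqType) (f : S -> seq T) (y : nat -> S) : Prop :=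
  exists2 k, 0 < k & k_decisive f y k.

Definition positive (S T : eqType) (f : S -> seq T) : Prop :=
  forall (a : S) (b : T), b \in f a.

(** The alphabets are finite subsets of one ambient type of letters [L], so that
    alphabets and substitutions at different levels can be compared. *)
Section Sequences.
Variable L : choiceType.

(** [compose0 tau n] is tau_{0,n} = tau_0 o ... o tau_{n-1}. *)
Fixpoint compose0 (A : nat -> {fset L}) (tau : forall n, A n.+1 -> seq (A n))
    (n : nat) : A n -> seq (A 0) :=
  match n return A n -> seq (A 0) with
  | 0 => fun b => [:: b]
  | n'.+1 => fun b => extend (compose0 tau (n := n')) (tau n' b)
  end.
Arguments compose0 {A} tau n _.

Variable A : nat -> {fset L}.

(** [compose tau m k] is tau_{m,m+k}.  The index is written [k + m] because
    [k.+1 + m] and [0 + m] reduce to [(k + m).+1] and [m]. *)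
Definition compose (tau : forall n, A n.+1 -> seq (A n)) (m k : nat) :
    A (k + m) -> seq (A m) :=
  @compose0 (fun i => A (i + m)) (fun i => tau (i + m)) k.

Definition congenial (tau : forall n, A n.+1 -> seq (A n))
    (a : forall n, A n) : Prop :=
  forall n, prefix [:: a n] (tau n (a n.+1)).

(** [y] is the limit x^(m) of tau_{m,n}(a_n) as n goes to infinity. *)
Definition generates (tau : forall n, A n.+1 -> seq (A n))
    (a : forall n, A n) (m : nat) (y : nat -> A m) : Prop :=
  word_limit (fun k => compose tau (a (k + m))) y.

(** The substitution tau_n bundled with its source and target alphabets. *)
Definition bundle (tau : forall n, A n.+1 -> seq (A n)) (n : nat) :
    {AB : {fset L} * {fset L} & AB.1 -> seq AB.2} :=
  existT (fun AB : {fset L} * {fset L} => AB.1 -> seq AB.2)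
    (A n.+1, A n) (tau n).

End Sequences.

Arguments compose0 {L A} tau n _.
Arguments compose {L A} tau m k _.
Arguments generates {L A} tau a m y.

(* Main.v *)
(** Take the least [n] such that all words tau_{0,n}(c) are at least as long as
    [w], and cut [x] into the blocks tau_{0,n+1}(b), with [b] running along
    x^(n+1).  As tau_n is decisive, [b] determines the first letter [c] of
    the image under tau_n of the letter after [b], so the block of [b] is
    followed by tau_{0,n}(c), and [b] alone determines which occurrences of [w]
    start in its block.  Hence, up to boundary blocks, the occurrences of [w] in
    a factor of [x] form a sum over the letters of a factor of x^(n+1), and
    letter-balance bounds the difference of two such sums.  The constant depends
    on [w] only through B_{n+1}: two occurrences of [w] are more than |w| / P
    apart by power-freeness and blocks have length O(|w|) by minimality of [n],
    so a block contains boundedly many occurrences. *)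

Require Import Defs.
From mathcomp Require Import all_boot ssrint.
From mathcomp Require Import finmap classical_sets cardinality.
From mathcomp Require Import zify.

Set Implicit Arguments.
Unset Strict Implicit.
Unset Printing Implicit Defensive.

(** * Window sums and desubstitution *)

Definition wsum (f : nat -> nat) (i l : nat) : nat := \sum_(t <- iota i l) f t.

Lemma wsumD f i l1 l2 : wsum f i (l1 + l2) = wsum f i l1 + wsum f (i + l1) l2.
Proof. by rewrite /wsum iotaD big_cat. Qed.

Lemma wsum1 f i : wsum f i 1 = f i.
Proof. by rewrite /wsum big_seq1. Qed.

Lemma wsum_le_mul f i l C : (forall t, f t <= C) -> wsum f i l <= l * C.
Proof.
move=> fC; elim: l i => [|l IH] i; first by rewrite /wsum big_nil.
by rewrite -add1n wsumD wsum1 mulnDl mul1n leq_add.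
Qed.

Lemma wsum_ge_mul f i l k M :
  (forall t, M <= k * f t) -> l * M <= k * wsum f i l.
Proof.
move=> fM; elim: l i => [|l IH] i; first by rewrite mul0n.
by rewrite -add1n wsumD wsum1 mulnDl mul1n mulnDr leq_add.
Qed.

Lemma wsum_mono f i l1 l2 : l1 <= l2 -> wsum f i l1 <= wsum f i l2.
Proof. by move=> /subnKC <-; rewrite wsumD leq_addr. Qed.

Lemma wsum_map (T : Type) (g : T -> nat) (y : nat -> T) i l :
  wsum (fun t => g (y t)) i l = \sum_(b <- [seq y t | t <- iota i l]) g b.
Proof. by rewrite big_map. Qed.

Lemma wsum_chunks f d k i :
  (forall j, wsum f j d <= 1) -> wsum f i (k * d) <= k.
Proof.
move=> h; elim: k i => [|k IH] i; first by rewrite /wsum big_nil.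
by rewrite mulSn wsumD -add1n leq_add.
Qed.

(** If [e] holds at the first position, the gap condition makes all other terms vanish; otherwise
    that position is dropped. *)
Lemma wsum_le1 (e : nat -> bool) i d :
  (forall s t, e s -> e t -> s < t -> t < s + d -> False) ->
  wsum e i d <= 1.
Proof.
move=> he; have: forall k i, k <= d -> wsum e i k <= 1; last exact.
elim=> [|k IH] j kd; first by rewrite /wsum big_nil.
rewrite -add1n wsumD wsum1; have [ej|_] := boolP (e j); last first.
  by rewrite add0n IH // ltnW.
suff -> : wsum e (j + 1) k = 0 by [].
rewrite /wsum big_seq big1 // => t; rewrite mem_iota => /andP[jt tk].
by have [et|//] := boolP (e t); case: (he j t ej et); lia.
Qed.

Lemma sum_by_letter (T : finType) (g : T -> nat) (u : seq T) :
  \sum_(b <- u) g b = \sum_b g b * count_mem b u.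
Proof.
elim: u => [|c u IH]; first by rewrite big_nil big1 // => b _; rewrite muln0.
rewrite big_cons IH /=; under [RHS]eq_bigr do rewrite mulnDr.
rewrite big_split /= [X in _ = X + _](bigD1 c) //= eqxx muln1.
rewrite [X in _ + X + _]big1 ?addn0 // => b.
by rewrite eq_sym => /negPf ->; rewrite muln0.
Qed.

Lemma occ_cons (T : eqType) (w : seq T) c u :
  occ w (c :: u) = prefix w (c :: u) + occ w u.
Proof.
rewrite {1}/occ -[(size (c :: u)).+1]add1n iotaD count_cat [0 + 1]addnC
  iotaDl count_map; congr (_ + _); exact: addn0.
Qed.

Lemma occ_letter (T : eqType) (b : T) u : occ [:: b] u = count_mem b u.
Proof.
elim: u => [|c u IH] //; rewrite occ_cons IH /= eq_sym.
by rewrite prefix0s andbT.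
Qed.

(** Grouping by letters turns each sum into weights times multiplicities. Between the two windows
    each multiplicity differs by at most [B], so each letter costs at most [B * G]. *)
Lemma letter_balanced_sum (T : finType) (y : nat -> T) (g : T -> nat) B G m p q :
  letter_balanced y B -> (forall b, g b <= G) ->
  wsum (fun t => g (y t)) m q <= wsum (fun t => g (y t)) p q + #|T| * B * G.
Proof.
move=> yB gG; rewrite !wsum_map [in leqLHS]sum_by_letter [in leqRHS]sum_by_letter.
rewrite (_ : #|T| * B * G = \sum_(b : T) B * G); last first.
  by rewrite sum_nat_const mulnA.
rewrite -big_split /=; apply: leq_sum => b _.
have fac i : factor y [seq y t | t <- iota i q].
  by exists i; rewrite size_map size_iota.
have := yB b _ _ (fac m) (fac p); rewrite !size_map !size_iota => /(_ erefl).
rewrite !occ_letter; set c := count _ _; set c' := count _ _ => cc'.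
have {}cc' : c <= c' + B by lia.
rewrite -mulnC [B * G]mulnC.
apply: leq_trans (_ : g b * (c' + B) <= _).
  by rewrite mulnC leq_mul2l cc' orbT.
by rewrite mulnDr leq_add2l leq_mul2r gG orbT.
Qed.

Section Desubstitution.
Variables (T : finType) (y : nat -> T) (len g : T -> nat) (e : nat -> nat).
Variables (B M G k : nat).
(** Blocks of length [len (y t)] are laid end to end from position 0: [L 0 m] is where block [m]
    starts, and [O m q] is the total weight of the [q] blocks from [m] on. *)
Let L := wsum (fun t => len (y t)).
Let O := wsum (fun t => g (y t)).

Hypothesis yB : letter_balanced y B.
Hypothesis len_gt0 : forall b, 0 < len b.
Hypothesis lenM : forall b, len b <= M.
Hypothesis Mlen : forall b, M <= k * len b.
Hypothesis eG : forall i l, l <= M -> wsum e i l <= G.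
Hypothesis e_block : forall m, wsum e (L 0 m) (len (y m)) = g (y m).

Lemma block_start m q : L 0 (m + q) = L 0 m + L m q.
Proof. by rewrite /L wsumD. Qed.

Lemma block_of i : exists m, L 0 m <= i < L 0 m.+1.
Proof.
have LS m : L 0 m.+1 = L 0 m + len (y m) by rewrite -addn1 block_start /L wsum1.
elim: i => [|i [m /andP[mi im]]].
  by exists 0; rewrite LS /L /wsum big_nil len_gt0.
have [h|h] := ltnP i.+1 (L 0 m.+1); first by exists m; rewrite h ltnW.
exists m.+1; rewrite h LS /=; have := len_gt0 (y m.+1); lia.
Qed.

Lemma wsum_blocks m q : wsum e (L 0 m) (L m q) = O m q.
Proof.
elim: q m => [|q IH] m; first by rewrite /L /O /wsum !big_nil.
rewrite -add1n /L /O !wsumD !wsum1 -/L -/O e_block -IH.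
rewrite addn1 -[L 0 m + _](_ : L 0 m.+1 = _) //.
by rewrite -addn1 block_start /L wsum1.
Qed.

(** Both ends of the window move back to the starts of the blocks containing them. Each move is at
    most [M], so it changes the count by at most [G], and the two errors have opposite signs. *)
Lemma window_blocks i l : exists m q,
  [/\ wsum e i l <= O m q + G, O m q <= wsum e i l + G,
      l <= L m q + M & L m q <= l + M].
Proof.
have LS m : L 0 m.+1 = L 0 m + len (y m) by rewrite -addn1 block_start /L wsum1.
have [m /andP[mi im]] := block_of i; have [m' /andP[mi' im']] := block_of (i + l).
have mm' : m <= m'.
  rewrite leqNgt; apply/negP => lt_m'm.
  have := block_start m'.+1 (m - m'.+1); rewrite subnKC //; lia.
exists m, (m' - m); set q := m' - m.
have Em' : L 0 m' = L 0 m + L m q by rewrite -block_start subnKC.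
pose a := i - L 0 m; pose b := i + l - L 0 m'.
have aM : a <= M by have := lenM (y m); move: im; rewrite LS /a; lia.
have bM : b <= M by have := lenM (y m'); move: im'; rewrite LS /b; lia.
(* The count from the start of block [m] to [i + l] is split in two ways: at [i], and at the start
   of block [m']. *)
have : wsum e (L 0 m) (a + l) = wsum e (L 0 m) (L m q + b) by congr wsum; lia.
rewrite !wsumD wsum_blocks -Em' (_ : L 0 m + a = i); last by rewrite /a; lia.
have := eG (L 0 m) aM; have := eG (L 0 m') bM; split; lia.
Qed.

(** The slack [2 * M] is one rounding error per window. Equal numbers of blocks are compared by
    letter balance. Surplus blocks are few: letter balance weighted by [len] bounds their total
    length, and each has length at least [M / k]. *)
Lemma blocks_balanced m q p q' : L m q <= L p q' + 2 * M ->
  O m q <= O p q' + #|T| * B * G + (#|T| * B + 2) * k * G.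
Proof.
(* [g] is controlled only on the letters that occur in [y], hence the cut-off. *)
pose g' b := minn (g b) G.
have gG t : g (y t) <= G by rewrite -e_block eG.
have OE i l : O i l = wsum (fun t => g' (y t)) i l.
  by apply: eq_bigr => t _; rewrite /g' (minn_idPl (gG t)).
have bal i j l : O i l <= O j l + #|T| * B * G.
  by rewrite !OE; apply: letter_balanced_sum => // b; exact: geq_minr.
have [qq' _|qq' hL] := leqP q q'.
  have := bal m p q; have : O p q <= O p q' by exact: wsum_mono.
  lia.
rewrite -(subnKC (ltnW qq')) in hL *; set d := q - q' in hL *.
rewrite /L wsumD -/L in hL; rewrite {1}/O wsumD -/O.
have Lbal := letter_balanced_sum p m q' yB lenM; rewrite -/L in Lbal.
have Ld : L (m + q') d <= (#|T| * B + 2) * M by lia.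
have dk : d <= (#|T| * B + 2) * k.
  have M_gt0 : 0 < M by apply: leq_trans (lenM (y 0)).
  rewrite -(leq_pmul2r M_gt0).
  apply: leq_trans (wsum_ge_mul (m + q') d (fun t => Mlen (y t))) _.
  by rewrite -/L mulnAC mulnC leq_mul2r Ld orbT.
have Od : O (m + q') d <= (#|T| * B + 2) * k * G.
  apply: leq_trans (wsum_le_mul _ _ gG) _.
  by rewrite leq_mul2r dk orbT.
have := bal m p q'; lia.
Qed.

Lemma window_balanced i j l : wsum e i l <= wsum e j l +
  (2 * G + #|T| * B * G + (#|T| * B + 2) * k * G).
Proof.
have [m [q [h1 _ _ h4]]] := window_blocks i l.
have [p [q' [_ h2 h3 _]]] := window_blocks j l.
have := @blocks_balanced m q p q'; lia.
Qed.

End Desubstitution.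

(** * Occurrences in infinite words *)

Definition occurs_at (T : eqType) (x : nat -> T) (w : seq T) (t : nat) : bool :=
  [seq x j | j <- iota t (size w)] == w.

Lemma prefix_window (T : eqType) (x : nat -> T) w i l : size w <= l ->
  prefix w [seq x j | j <- iota i l] = occurs_at x w i.
Proof. by move=> wl; rewrite prefixE -map_take take_iota (minn_idPl wl). Qed.

Lemma occ_factor (T : eqType) (x : nat -> T) w i l : w != [::] ->
  occ w [seq x j | j <- iota i l] = wsum (occurs_at x w) i (l.+1 - size w).
Proof.
rewrite -size_eq0 -lt0n => w0; elim: l i => [|l IH] i.
  rewrite (_ : 1 - size w = 0); last by lia.
  by rewrite /wsum big_nil; case: w w0.
rewrite occ_cons IH -/(iota i l.+1) -[x i :: _]/[seq x j | j <- iota i l.+1].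
have [wl|lw] := leqP (size w) l.+1.
  rewrite prefix_window // (_ : l.+2 - _ = 1 + (l.+1 - size w)); last by lia.
  by rewrite wsumD wsum1 addn1.
have [-> ->] : l.+2 - size w = 0 /\ l.+1 - size w = 0 by lia.
rewrite /wsum !big_nil addn0; apply/eqP; rewrite eqb0; apply/negP.
by move=> /size_prefix; rewrite size_map size_iota leqNgt lw.
Qed.

(** Two occurrences at distance [p] give [w] the period [p]; if [P * p <= size w], then [w] begins
    with the [P]-th power of its first [p] letters. *)
Lemma power_free_gap (T : eqType) (x : nat -> T) P w s t : power_free P x ->
  occurs_at x w s -> occurs_at x w t -> s < t -> size w < P * (t - s).
Proof.
move=> pf /eqP ws /eqP wt st; rewrite ltnNge; apply/negP => Pp.
set p := t - s in Pp.
have per j : j < size w -> x (s + p + j) = x (s + j).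
  have tE : s + p = t by rewrite /p; lia.
  move=> jw; rewrite tE.
  have e i : nth (x 0) [seq x j | j <- iota i (size w)] j = x (i + j).
    by rewrite (nth_map 0) ?size_iota // nth_iota.
  by rewrite -e wt -{1}ws e.
pose v := [seq x j | j <- iota s p].
have powE k : k * p <= size w -> word_power v k = [seq x j | j <- iota s (k * p)].
  elim: k => [|k IH] //; rewrite mulSn iotaD map_cat => kw.
  rewrite /word_power /= -/(word_power v k) IH; last by lia.
  congr (_ ++ _); rewrite -[s in RHS]addn0 -[s in LHS]addn0 addnAC !iotaDl.
  rewrite -!map_comp.
  by apply/eq_in_map => j; rewrite mem_iota /= => jk; rewrite per //; lia.
apply: (pf v).
  by rewrite -size_eq0 size_map size_iota -lt0n subn_gt0.
by exists s; rewrite powE // size_map size_iota.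
Qed.

(** * Images of infinite words under substitutions *)

Lemma extend_cat (S T : Type) (f : S -> seq T) u v :
  extend f (u ++ v) = extend f u ++ extend f v.
Proof. by rewrite /extend map_cat flatten_cat. Qed.

Lemma extend_comp (S T U : Type) (f : T -> seq U) (g : S -> seq T) w :
  extend (fun b => extend f (g b)) w = extend f (extend g w).
Proof. by elim: w => //= b w IH; rewrite [RHS]extend_cat -IH. Qed.

Lemma extend_prefix (S T : eqType) (f : S -> seq T) u v :
  prefix u v -> prefix (extend f u) (extend f v).
Proof. by case/prefixP => s ->; rewrite extend_cat prefix_prefix. Qed.

Lemma prefix_of_size (T : eqType) (s t u : seq T) :
  prefix s u -> prefix t u -> size s = size t -> s = t.
Proof. by rewrite !prefixE => /eqP su /eqP tu st; rewrite -su -tu st. Qed.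

Section Image.
Variables (S T : eqType) (f h : S -> seq T) (y : nat -> S) (x : nat -> T).
Hypothesis image : forall l, exists n, extend f (mkseq y l) = mkseq x n.
Hypothesis next : forall m, prefix (h (y m)) (f (y m.+1)).
Let pos := wsum (fun t => size (f (y t))) 0.

Lemma size_extend_mkseq l : size (extend f (mkseq y l)) = pos l.
Proof.
rewrite size_flatten /shape sumnE big_map /pos (wsum_map (size \o f)).
by rewrite big_map big_map.
Qed.

Lemma image_block m : f (y m) ++ h (y m) =
  [seq x j | j <- iota (pos m) (size (f (y m)) + size (h (y m)))].
Proof.
(* The prefix of length [m.+2] also covers the block after that of [y m], which begins with
   [h (y m)]. *)
have [n En] := image m.+2; have /prefixP[s Es] := next m.
have nE : n = pos m.+2 by rewrite -size_extend_mkseq En size_mkseq.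
have p2 : pos m.+2 = pos m + (size (f (y m)) + size (h (y m)) + size s).
  rewrite -addn2 /pos wsumD (wsumD _ _ 1 1) !wsum1 add0n addn1 Es size_cat.
  by rewrite -(addnA (size _)).
have : extend f (mkseq y m) ++ ((f (y m) ++ h (y m)) ++ s) =
  mkseq x (pos m) ++ [seq x j | j <- iota (pos m) (size (f (y m)) + size (h (y m)))]
  ++ [seq x j | j <- iota (pos m + (size (f (y m)) + size (h (y m)))) (size s)].
  rewrite /mkseq -map_cat -map_cat -!iotaD -p2 -nE -[RHS]/(mkseq x n) -En.
  rewrite -catA -Es -addn2 /mkseq iotaD map_cat extend_cat /extend /=.
  by rewrite cats0.
move=> /eqP; rewrite !eqseq_cat ?size_extend_mkseq ?size_mkseq //.
  by case/and3P => _ /eqP.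
by rewrite size_cat size_map size_iota.
Qed.

(** An occurrence starting in the block of [y m] ends within the [h (y m)] that follows, so the
    letter [y m] alone decides it. *)
Lemma occurs_in_block w m t : size w <= size (h (y m)) -> t < size (f (y m)) ->
  occurs_at x w (pos m + t) = prefix w (drop t (f (y m) ++ h (y m))).
Proof.
move=> wh tf; rewrite image_block -map_drop drop_iota prefix_window //; lia.
Qed.

Definition block_occ (w : seq T) (b : S) : nat :=
  \sum_(t <- iota 0 (size (f b))) prefix w (drop t (f b ++ h b)).

Lemma wsum_block w m : size w <= size (h (y m)) ->
  wsum (occurs_at x w) (pos m) (size (f (y m))) = block_occ w (y m).
Proof.
move=> wh; rewrite /wsum -[pos m in LHS]addn0 iotaDl big_map /block_occ.
rewrite big_seq [RHS]big_seq; apply: eq_bigr => t.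
by rewrite mem_iota => /andP[_ tf]; rewrite occurs_in_block.
Qed.

End Image.

(** * Congenial sequences *)

Lemma eq_extend_map (S S' T U : Type) (f : S -> seq T) (g : S' -> seq T)
    (p : S -> U) (q : S' -> U) u v :
  (forall b c, p b = q c -> f b = g c) -> map p u = map q v ->
  extend f u = extend g v.
Proof.
move=> fg; elim: u v => [|b u IH] [|c v] //= [bc uv].
by rewrite /extend /= (fg _ _ bc) -/(extend f u) (IH _ uv).
Qed.

Section Composition.
Variables (L : choiceType) (A : nat -> {fset L}).
Variables (tau : forall n, A n.+1 -> seq (A n)) (a : forall n, A n).

Lemma compose0_add N k b :
  compose0 tau (k + N) b = extend (compose0 tau N) (compose tau N k b).
Proof.
elim: k b => [|k IH] b; first by rewrite /extend /= cats0.
rewrite -[RHS]extend_comp; rewrite -[LHS]/(extend _ (tau b)).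
by congr flatten; apply: eq_map => c; exact: IH.
Qed.

(* [A (n + 0)] and [A n] are not convertible, so letters are compared in [L]. *)
Lemma tau_val n m (b : A n.+1) (c : A m.+1) : n = m -> val b = val c ->
  map val (tau b) = map val (tau c).
Proof. by move=> nm; subst m => /val_inj ->. Qed.

Lemma compose_base n (b : A (n + 0)) (c : A n) : val b = val c ->
  compose tau 0 n b = compose0 tau n c.
Proof.
elim: n b c => [|n IH] b c bc; first by congr [:: _]; exact: val_inj.
apply: (@eq_extend_map _ _ _ _ _ _ val val) => //.
by apply: tau_val; rewrite ?addn0.
Qed.

Lemma compose_base_first n : compose tau 0 n (a (n + 0)) = compose0 tau n (a n).
Proof.
apply: compose_base; have : n + 0 = n by rewrite addn0.
by move: (n + 0) => m ->.
Qed.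

Lemma generates_image N x y : generates tau a 0 x -> generates tau a N y ->
  forall l, exists n, extend (compose0 tau N) (mkseq y l) = mkseq x n.
Proof.
move=> gx gy l; exists (size (extend (compose0 tau N) (mkseq y l))).
have [k1 h1] := gx (size (extend (compose0 tau N) (mkseq y l))).
have [k2 h2] := gy l.
(* The level [k1 + k2 + N] lies beyond both thresholds, so the prefix of [x] and the image of the
   prefix of [y] are prefixes of one word. *)
have {h1} := h1 (k1 + k2 + N); rewrite compose_base_first compose0_add => h1.
apply: prefix_of_size (h1 _) _; last by rewrite size_mkseq.
  by apply: extend_prefix; apply: h2; lia.
by lia.
Qed.

Hypothesis cong : congenial tau a.

Lemma compose0_first n : 0 < size (compose0 tau n (a n)).
Proof.
elim: n => // n IH; have /prefixP[s Es] := cong n.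
by rewrite /= Es /extend /= size_cat addn_gt0 IH.
Qed.

(** Congeniality makes the image of [a n] nonempty, and the ratio bound transfers this to every
    letter. *)
Lemma compose0_gt0 K n b :
  (forall n (b c : A n), 1 <= n ->
     size (compose0 tau n b) <= K * size (compose0 tau n c)) ->
  0 < size (compose0 tau n b).
Proof.
move=> ratio; case: n b => // n b; have := ratio _ (a n.+1) b isT.
by rewrite [0 < _]lt0n; case: eqP => // ->; rewrite muln0 leqNgt compose0_first.
Qed.

(** Over a one-letter alphabet, [x] would begin with the [P]-th power of the image of [a n]. *)
Lemma two_letters P x n (y : nat -> A n) : power_free P x ->
  generates tau a 0 x -> generates tau a n y -> exists b c : A n, b != c.
Proof.
move=> pf gx gy; case: (boolP [exists b : A n, exists c : A n, b != c]).
  by move=> /existsP[b /existsP[c bc]]; exists b, c.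
move=> /existsPn h; exfalso.
have all_eq b : b = a n.
  by have /existsPn/(_ (a n)) := h b; rewrite negbK => /eqP.
apply: (pf (compose0 tau n (a n))).
  by rewrite -size_eq0 -lt0n compose0_first.
have [m] := generates_image gx gy P.
rewrite /extend (_ : mkseq y P = nseq P (a n)); last first.
  rewrite -[in RHS](size_mkseq y P); apply/all_pred1P/allP => b _.
  by rewrite /= [b]all_eq.
rewrite map_nseq -/(word_power _ P) => ->.
by exists 0; rewrite size_mkseq.
Qed.

(** By positivity, each image under [compose tau n k] contains two distinct letters, so climbing [k]
    levels raises the minimal length by at least one. *)
Lemma compose0_growth P x (ys : forall n, nat -> A n) k K l :
  power_free P x -> generates tau a 0 x -> (forall n, generates tau a n (ys n)) ->
  (forall n, positive (compose tau n k)) ->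
  (forall n (b c : A n), 1 <= n ->
     size (compose0 tau n b) <= K * size (compose0 tau n c)) ->
  exists n, forall b : A n, l <= size (compose0 tau n b).
Proof.
move=> pf gx gys pos ratio; elim: l => [|l [n IH]]; first by exists 0.
exists (k + n) => b; rewrite compose0_add.
have [c [d cd]] := two_letters pf gx (gys n).
have : {subset [:: c; d] <= compose tau n k b} by move=> t _; exact: pos.
move=> /uniq_leq_size; rewrite /= inE cd => /(_ isT).
case: (compose _ _ _ _) => [|b1 [|b2 s]] //= _.
rewrite /extend /= !size_cat.
by have := IH b1; have := compose0_gt0 b2 ratio; lia.
Qed.

End Composition.

(** * Choice of the level and balance constants *)

Lemma size_extend_le (S T : Type) (f : S -> seq T) M u :
  (forall b, size (f b) <= M) -> size (extend f u) <= size u * M.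
Proof.
move=> fM; elim: u => // b u IH.
by rewrite /extend /= size_cat mulSn leq_add.
Qed.

Lemma balanced_nil (T : eqType) (y : nat -> T) C : balanced y [::] C.
Proof.
have occ0 u : occ ([::] : seq T) u = (size u).+1.
  by elim: u => // c u IH; rewrite occ_cons IH prefix0s.
by move=> u v _ _ uv; rewrite !occ0 uv distnn.
Qed.

Lemma balanced_of_windows (T : eqType) (x : nat -> T) w C : w != [::] ->
  (forall i j l, wsum (occurs_at x w) i l <= wsum (occurs_at x w) j l + C) ->
  balanced x w C.
Proof.
move=> w0 hC u v [i ->] [j ->]; rewrite !size_map !size_iota => <-.
rewrite !occ_factor //; set l := _ - _.
have := hC i j l; have := hC j i l; lia.
Qed.

Lemma power_free_windows (T : eqType) (x : nat -> T) P w k i l :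
  0 < P -> power_free P x -> l <= k * size w ->
  wsum (occurs_at x w) i l <= k * P.
Proof.
(* [d] is the least integer above [size w / P]: a window of length [d] holds at most one occurrence,
   and [k * P] such windows cover length [k * size w]. *)
move=> P_gt0 pf lk; pose d := (size w %/ P).+1.
have wd : size w <= P * d.
  by rewrite mulnC /d mulSn {1}(divn_eq (size w) P) addnC leq_add2r ltnW ?ltn_pmod.
apply: leq_trans (wsum_mono _ _ (_ : l <= k * P * d)) _.
  by apply: leq_trans lk _; rewrite -mulnA leq_mul2l wd orbT.
apply: wsum_chunks => j; apply: wsum_le1 => s t es et st td.
have := power_free_gap pf es et st; rewrite ltnNge => /negP; apply.
have : t - s <= size w %/ P by rewrite /d in td; lia.
by move=> h; rewrite mulnC -leq_divRL.
Qed.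

(** The bound of [window_balanced], with [K] for the alphabet size and [K * K] for the ratio of [M]
    to a block length. *)
Definition balance_const (K B G : nat) : nat :=
  2 * G + K * B * G + (K * B + 2) * (K * K) * G.

Lemma leq_balance_const K B B' G G' : B <= B' -> G <= G' ->
  balance_const K B G <= balance_const K B' G'.
Proof.
by move=> BB GG; rewrite /balance_const !leq_add ?leq_mul ?leq_add ?leq_mul.
Qed.

Lemma balanced_leq (T : eqType) (y : nat -> T) w C C' :
  C <= C' -> balanced y w C -> balanced y w C'.
Proof. by move=> CC' h u v fu fv uv; apply: leq_trans (h u v fu fv uv) CC'. Qed.

Section Levels.
Variables (L : choiceType) (A : nat -> {fset L}).
Variables (tau : forall n, A n.+1 -> seq (A n)) (a : forall n, A n).
Variables (x : nat -> A 0) (y : forall n, nat -> A n) (K : nat) (B : nat -> nat).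
Hypothesis cong : congenial tau a.
Hypothesis gen : generates tau a 0 x.
Hypothesis gens : forall n, generates tau a n (y n).
Hypothesis dec : forall n, decisive (@tau n) (y n.+1).
Hypothesis tauK : forall n (b : A n.+1), size (tau b) <= K.
Hypothesis AK : forall n, #|` A n| <= K.
Hypothesis ratio : forall n (b c : A n), 1 <= n ->
  size (compose0 tau n b) <= K * size (compose0 tau n c).
Hypothesis yB : forall n, letter_balanced (y n) (B n).

Lemma next_block n : exists h : A n.+1 -> A n, forall m,
  prefix (compose0 tau n (h (y n.+1 m))) (compose0 tau n.+1 (y n.+1 m.+1)).
Proof.
(* Positivity of the decisive length makes [r b] nonempty, so it has a first letter
   [thead (r b)]. *)
have [[//|k] _ [r hr]] := dec n; exists (fun b => thead (r b)) => m.
have : factor (y n.+1) [:: y n.+1 m; y n.+1 m.+1] by exists m.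
move=> /hr /(extend_prefix (compose0 tau n)); apply: prefix_trans.
rewrite [X in extend _ X](_ : _ = thead (r (y n.+1 m)) :: behead (r (y n.+1 m))).
  exact: prefix_prefix.
by case: (r _) => -[].
Qed.

(** By the ratio bound, [M] is at least every block length at level [n.+1] and at most [K * K] times
    each of them. *)
Lemma balanced_at_level n w M G : w != [::] ->
  (forall b : A n, size w <= size (compose0 tau n b)) ->
  M = K * size (compose0 tau n.+1 (a n.+1)) ->
  (forall i l, l <= M -> wsum (occurs_at x w) i l <= G) ->
  balanced x w (balance_const K (B n.+1) G).
Proof.
move=> w0 wn ME MG; have [h hh] := next_block n.
apply: balanced_of_windows => // i j l.
have image := generates_image gen (gens n.+1).
apply: leq_trans
  (@window_balanced _ (y n.+1) (fun b => size (compose0 tau n.+1 b))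
    (block_occ (compose0 tau n.+1) (fun b => compose0 tau n (h b)) w)
    (occurs_at x w) (B n.+1) M G (K * K) _ _ _ _ _ _ i j l) _.
- exact: yB.
- by move=> b; apply: compose0_gt0 ratio.
- by move=> b; rewrite ME ratio.
- by move=> b; rewrite ME -mulnA leq_mul2l ratio // orbT.
- exact: MG.
- by move=> m; apply: (wsum_block image hh).
by rewrite leq_add2l /balance_const -cardfE !leq_add ?leq_mul ?leq_add ?leq_mul.
Qed.

(** At the least long level [m.+1], some image one level below is shorter than [w], so all images
    there have length at most [K * size w]; one more substitution costs another factor [K]. *)
Lemma first_long_level (w : seq (A 0)) n : 0 < K -> w != [::] ->
  (forall b : A n, size w <= size (compose0 tau n b)) ->
  exists m, [/\ forall b : A m, size w <= size (compose0 tau m b) &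
    forall b : A m, size (compose0 tau m b) <= K * K * size w].
Proof.
rewrite -size_eq0 -lt0n => K0 w0 hn.
pose long m := [forall b : A m, size w <= size (compose0 tau m b)].
have ex : exists m, long m by exists n; apply/forallP.
have [m /forallP longm minm] := ex_minnP ex; exists m; split=> // b.
have KK : 0 < K * K by rewrite muln_gt0 K0.
case: m longm minm b => [|m] _ minm b; first by rewrite muln_gt0 KK.
have /existsP[c] : [exists c : A m, ~~ (size w <= size (compose0 tau m c))].
  by rewrite -negb_forall; apply/negP => /minm; rewrite ltnn.
rewrite -ltnNge => cw.
have cK d : size (compose0 tau m d) <= K * size w.
  (* At level 0 the ratio bound does not apply, but images are single letters. *)
  case: m minm b c cw d => [|m] _ _ c cw d; first by rewrite muln_gt0 K0.
  by apply: leq_trans (ratio d c isT) _; rewrite leq_mul2l ltnW ?orbT.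
apply: leq_trans (size_extend_le _ cK) _.
by rewrite -mulnA leq_mul2r tauK orbT.
Qed.

End Levels.

Theorem theorem5p12 (L : choiceType) (A : nat -> {fset L})
    (tau : forall n, A n.+1 -> seq (A n)) (a : forall n, A n)
    (x : nat -> A 0) (xs : forall n, nat -> A n)
    (P K : nat) (B : nat -> nat)
    (hP : 1 <= P) (hx : power_free P x)
    (hcong : congenial tau a) (hgen : generates tau a 0 x)
    (hpos : exists2 k, 0 < k & forall n, positive (compose tau n k))
    (hfin : finite_set (range (bundle tau)))
    (hxs : forall n, generates tau a n (xs n))
    (hdec : forall n, decisive (tau n) (xs n.+1))
    (hK : 0 < K)
    (hKtau : forall n (b : A n.+1), size (tau n b) <= K)
    (hKA : forall n, #|` A n| <= K)
    (hKratio : forall n (b c : A n), 1 <= n ->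
       size (compose0 tau n b) <= K * size (compose0 tau n c))
    (hB : forall n, letter_balanced (xs n) (B n)) :
  factor_balanced x /\
  ((exists M, forall n, B n <= M) -> uniformly_factor_balanced x).
Proof.
(* In [G], the factor [K * K] bounds images at level [n] relative to [size w], the next [K] passes
   to level [n.+1], the outer [K] comes from the choice of [M], and [P] from power-freeness. *)
have [k _ pos] := hpos; pose G := K * (K * (K * K)) * P.
have bal w : exists n, balanced x w (balance_const K (B n) G).
  have [->|w0] := eqVneq w [::]; first by exists 0; exact: balanced_nil.
  have [n0 hn0] := compose0_growth hcong (size w) hx hgen hxs pos hKratio.
  have [n [wn nw]] := first_long_level hKtau hKratio hK w0 hn0.
  exists n.+1; apply: (balanced_at_level hcong hgen hxs hdec hKA hKratio hB w0 wn erefl).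
  move=> i l hl; apply: power_free_windows => //; apply: leq_trans hl _.
  rewrite -mulnA leq_mul2l -mulnA; apply/orP; right.
  by apply: leq_trans (size_extend_le _ nw) _; rewrite leq_mul2r hKtau orbT.
split=> [w|[M BM]]; first by have [n] := bal w; exists (balance_const K (B n) G).
(* [G] is independent of [w], so only the bound on the [B n] is needed for uniformity. *)
exists (balance_const K M G) => w; have [n] := bal w.
by apply: balanced_leq; apply: leq_balance_const.
Qed.
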